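(* Let $X$ and $Y$ be two Hilbert spaces. Let $T,S\in B(X,Y)$ and let $R(T)$ be closed. Then the Moore-Penrose inverse $(T-\lambda S)^\dagger$ of the linear pencil $\lambda\mapsto T-\lambda S$ is its analytic generalized resolvent on a neighborhood of $0$ (that is, on some neighborhood of $0$ the Moore-Penrose inverse $(T-\lambda S)^\dagger$ exists for every $\lambda$ and $\lambda\mapsto (T-\lambda S)^\dagger$ is an analytic generalized resolvent of the pencil) if and only if there exists a neighborhood $U$ of $0$ such that for all $\lambda\in U$, $$N(T-\lambda S)=N(T)\quad\text{and}\quad R(T-\lambda S)=R(T).$$
   Context: All spaces are complex. $B(X,Y)$ is the Banach space of bounded linear operators from $X$ to $Y$; $N(\cdot)$ and $R(\cdot)$ denote null space and range. An operator $A^\dagger\in B(Y,X)$ is the Moore-Penrose inverse of $A\in B(X,Y)$ if $AA^\dagger A=A$, $A^\dagger AA^\dagger=A^\dagger$, $(AA^\dagger)^*=AA^\dagger$ and $(A^\dagger A)^*=A^\dagger A$, where $^*$ denotes the adjoint. For an open set $U\subset\mathbb{C}$, a function $U\ni\lambda\mapsto G(\lambda)\in B(Y,X)$ is a generalized resolvent on $U$ of the linear pencil $\lambda\mapsto T-\lambda S$ if: (i) $(T-\lambda S)G(\lambda)(T-\lambda S)=T-\lambda S$ for all $\lambda\in U$; (ii) $G(\lambda)(T-\lambda S)G(\lambda)=G(\lambda)$ for all $\lambda\in U$; (iii) $G(\lambda)-G(\mu)=(\lambda-\mu)G(\lambda)SG(\mu)$ for all $\lambda,\mu\in U$. It is an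 analytic generalized resolvent if moreover $\lambda\mapsto G(\lambda)$ is analytic on $U$. Neighborhoods of $0$ are open subsets of $\mathbb{C}$ containing $0$. *)

(* Defs.v *)
From HB Require Import structures.
From mathcomp Require Import all_boot all_order all_algebra.
From mathcomp Require Import sesquilinear complex.
From mathcomp Require Import boolp classical_sets functions reals.
From mathcomp Require Import topology normedtype sequences.

Set Implicit Arguments.
Unset Strict Implicit.
Unset Printing Implicit Defensive.

Import Order.TTheory GRing.Theory Num.Theory.
Import numFieldNormedType.Exports.

Local Open Scope classical_set_scope.
Local Open Scope ring_scope.
Local Open Scope complex_scope.

(* The inner product is linear in its first argument and conjugate-linear in  *)
(* the second.  Norms of complex normed modules take their values in [R[i]].  *)
HB.mixin Record CompleteNormedModule_isHilbert (R : realType) V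
    & CompleteNormedModule R[i] V := {
  inner : {dot V for @Num.conj R[i]};
  normr_sqr_inner : forall x : V, `|x| ^+ 2 = inner x x
}.

#[short(type="hilbertType")]
HB.structure Definition Hilbert (R : realType) :=
  {V of CompleteNormedModule R[i] V & CompleteNormedModule_isHilbert R V}.

Section BoundedOperators.
Context {R : realType}.

Section OperatorSpace.
Variables X Y : normedModType R[i].

Definition bounded_linear : {pred X -> Y} :=
  mem [set f : X -> Y | linear f /\ exists M, forall x, `|f x| <= M * `|x|].

Record bounded_op := BoundedOp {
  bounded_op_fun :> X -> Y;
  bounded_op_subproof : bounded_op_fun \in bounded_linear
}.

HB.instance Definition _ := [isSub for bounded_op_fun].
HB.instance Definition _ := [Choice of bounded_op by <:].

Lemma bounded_linear_submod : submod_closed bounded_linear.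
Proof.
split=> [|a f g].
  rewrite inE; split=> [b x y|]; first by rewrite /= scaler0 addr0.
  by exists 0 => x; rewrite normr0 mul0r.
rewrite !inE => -[lf [M fM]] [lg [N gN]]; split=> [b x y|].
  rewrite -[LHS]/(a *: f _ + g _) -[RHS]/(b *: (a *: f x + g x) + (a *: f y + g y)).
  by rewrite lf lg !scalerDr !scalerA (mulrC a b) addrACA.
exists (`|a| * M + N) => x; rewrite -[X in `|X|]/(a *: f x + g x).
rewrite (le_trans (ler_normD _ _))// normrZ mulrDl -mulrA lerD//.
by rewrite ler_wpM2l.
Qed.

HB.instance Definition _ :=
  GRing.isSubmodClosed.Build R[i] (X -> Y) bounded_linear bounded_linear_submod.
HB.instance Definition _ := [SubChoice_isSubLmodule of bounded_op by <:].

Lemma bounded_op_linear (f : bounded_op) : linear f.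
Proof. by case: f => f /= /[!inE] -[]. Qed.

HB.instance Definition _ (f : bounded_op) :=
  GRing.isLinear.Build R[i] X Y _ f (bounded_op_linear f).

Lemma bounded_opP (f : bounded_op) : exists M, forall x, `|f x| <= M * `|x|.
Proof. by case: f => f /= /[!inE] -[]. Qed.

Lemma bounded_op_eqP (f g : bounded_op) : f = g <-> f =1 g.
Proof. by split=> [->//|fg]; apply/val_inj/funext. Qed.

Lemma bounded_opDE (f g : bounded_op) x : (f + g) x = f x + g x.
Proof. by []. Qed.
Lemma bounded_opZE a (f : bounded_op) x : (a *: f) x = a *: f x.
Proof. by []. Qed.
Lemma bounded_opBE (f g : bounded_op) x : (f - g) x = f x - g x.
Proof. by []. Qed.

Definition opnorm (f : bounded_op) : R[i] :=
  (sup [set complex.Re `|f x| | x in [set x : X | `|x| <= 1]])%:C.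

Lemma Re_normK (V : normedModType R[i]) (v : V) : (complex.Re `|v|)%:C = `|v|.
Proof. by rewrite RRe_real// ger0_real. Qed.

Lemma opnorm_has_sup (f : bounded_op) :
  has_sup [set complex.Re `|f x| | x in [set x : X | `|x| <= 1]].
Proof.
split; first by exists (complex.Re `|f 0|), 0 => //=; rewrite normr0 ler01.
have [M fM] := bounded_opP f; exists (complex.Re `|M|) => _ [x /= x1 <-].
rewrite -lecR Re_normK (RRe_real (normr_real M)) (le_trans (fM x))//.
have [->|x0] := eqVneq x 0; first by rewrite normr0 mulr0.
have M0 : 0 <= M.
  by rewrite -(pmulr_lge0 _ (_ : 0 < `|x|)) ?normr_gt0// (le_trans _ (fM x)).
by rewrite (ger0_norm M0) ler_piMr.
Qed.

Lemma opnorm_ge0 (f : bounded_op) : 0 <= opnorm f.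
Proof.
rewrite /opnorm -[0]/(0%:C) lecR.
apply: ub_le_sup; first by case: (opnorm_has_sup f).
by exists 0; rewrite /= ?normr0 ?ler01// linear0 normr0.
Qed.

Lemma opnormP (f : bounded_op) x : `|f x| <= opnorm f * `|x|.
Proof.
have [->|x0] := eqVneq x 0; first by rewrite linear0 !normr0 mulr0.
have nx : 0 < `|x| by rewrite normr_gt0.
rewrite -ler_pdivrMr// mulrC -[X in X * _](ger0_norm (ltW _)) ?invr_gt0//.
rewrite -normrZ -linearZ -[leLHS]Re_normK /opnorm lecR.
apply: ub_le_sup; first by case: (opnorm_has_sup f).
exists (`|x|^-1 *: x) => //=.
by rewrite normrZ ger0_norm ?invr_ge0// mulVf// gt_eqF.
Qed.

Lemma opnorm_le (f : bounded_op) (M : R[i]) : 0 <= M ->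
  (forall x, `|f x| <= M * `|x|) -> opnorm f <= M.
Proof.
move=> M0 fM; rewrite -(RRe_real (ger0_real M0)) /opnorm lecR.
apply: ge_sup; first by case: (opnorm_has_sup f).
move=> _ [x /= x1 <-]; rewrite -lecR Re_normK RRe_real ?ger0_real//.
by rewrite (le_trans (fM x))// ler_piMr.
Qed.

Lemma opnormD (f g : bounded_op) : opnorm (f + g) <= opnorm f + opnorm g.
Proof.
apply: opnorm_le => [|x]; first by rewrite addr_ge0 ?opnorm_ge0.
by rewrite bounded_opDE (le_trans (ler_normD _ _))// mulrDl lerD ?opnormP.
Qed.

Lemma opnormZ (a : R[i]) (f : bounded_op) : opnorm (a *: f) = `|a| * opnorm f.
Proof.
have le b (h : bounded_op) : opnorm (b *: h) <= `|b| * opnorm h.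
  apply: opnorm_le => [|x]; first by rewrite mulr_ge0 ?opnorm_ge0.
  by rewrite bounded_opZE normrZ -mulrA ler_wpM2l ?opnormP.
apply/eqP; rewrite eq_le le/=; have [->|a0] := eqVneq a 0.
  by rewrite normr0 mul0r opnorm_ge0.
rewrite mulrC -ler_pdivlMr ?normr_gt0// mulrC -normfV.
by rewrite -[X in opnorm X <= _](scalerK a0).
Qed.

Lemma opnorm0_eq0 (f : bounded_op) : opnorm f = 0 -> f = 0.
Proof.
move=> f0; apply/bounded_op_eqP => x; apply/eqP; rewrite -normr_le0.
by rewrite (le_trans (opnormP f x))// f0 mul0r.
Qed.

HB.instance Definition _ :=
  Lmodule_isNormed.Build R[i] bounded_op opnormD opnormZ opnorm0_eq0.

End OperatorSpace.

Lemma bounded_comp_subproof (X Y Z : normedModType R[i])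
    (A : bounded_op Y Z) (B : bounded_op X Y) : A \o B \in @bounded_linear X Z.
Proof.
rewrite inE; split=> [a x y|]; first by rewrite /= !linearP.
exists (opnorm A * opnorm B) => x /=.
by rewrite (le_trans (opnormP _ _))// -mulrA ler_wpM2l ?opnorm_ge0 ?opnormP.
Qed.

Definition bounded_comp (X Y Z : normedModType R[i])
    (A : bounded_op Y Z) (B : bounded_op X Y) : bounded_op X Z :=
  BoundedOp (bounded_comp_subproof A B).

Definition null_space (X Y : normedModType R[i]) (A : bounded_op X Y) : set X :=
  [set x | A x = 0].

End BoundedOperators.

Notation "''B' ( X , Y )" := (bounded_op X Y)
  (at level 8, format "''B' ( X ,  Y )") : type_scope.
Notation "A \oB B" := (bounded_comp A B)
  (at level 40, left associativity) : ring_scope.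

Section Pencils.
Context {R : realType}.

(* [xget] selects the operator satisfying the defining identity; it is unique *)
(* and, by the Riesz representation theorem, it always exists.                *)
Definition adjoint (X Y : hilbertType R) (A : 'B(X, Y)) : 'B(Y, X) :=
  xget 0 [set B : 'B(Y, X) | forall x y, inner (A x) y = inner x (B y)].

Lemma inner_ext (X : hilbertType R) (x y : X) :
  (forall z, inner z x = inner z y) -> x = y.
Proof.
move=> xy; apply/eqP; rewrite -subr_eq0 -normr_eq0 -sqrf_eq0 normr_sqr_inner.
by rewrite linearBr /= xy subrr.
Qed.

Lemma adjointE (X Y : hilbertType R) (A : 'B(X, Y)) (B : 'B(Y, X)) :
  (forall x y, inner (A x) y = inner x (B y)) -> adjoint A = B.
Proof.
move=> AB; apply/bounded_op_eqP => y; apply: inner_ext => x; rewrite -AB.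
by rewrite (@xgetPex _ 0 [set B : 'B(Y, X) | forall x y,
  inner (A x) y = inner x (B y)])//; exists B.
Qed.

Definition is_moore_penrose (X Y : hilbertType R) (A : 'B(X, Y))
    (Ad : 'B(Y, X)) : Prop :=
  [/\ A \oB Ad \oB A = A,
      Ad \oB A \oB Ad = Ad,
      adjoint (A \oB Ad) = A \oB Ad
    & adjoint (Ad \oB A) = Ad \oB A].

Definition generalized_resolvent (X Y : normedModType R[i])
    (U : set R[i]^o) (T S : 'B(X, Y)) (G : R[i] -> 'B(Y, X)) : Prop :=
  [/\ forall l, U l -> (T - l *: S) \oB G l \oB (T - l *: S) = T - l *: S,
      forall l, U l -> G l \oB (T - l *: S) \oB G l = G l
    & forall l m, U l -> U m -> G l - G m = (l - m) *: (G l \oB S \oB G m)].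

(* Local expansion in a convergent power series; for 'B(Y, X)-valued maps the *)
(* convergence is in operator norm.  [R[i]^o] is [R[i]] with its topology.    *)
Definition analytic_on (V : normedModType R[i]) (U : set R[i]^o)
    (G : R[i] -> V) : Prop :=
  forall l0 : R[i]^o, U l0 -> exists a : nat -> V,
    \forall l \near l0,
      series (fun n => (l - l0) ^+ n *: a n) @ \oo --> G l.

Definition analytic_generalized_resolvent (X Y : normedModType R[i])
    (U : set R[i]^o) (T S : 'B(X, Y)) (G : R[i] -> 'B(Y, X)) : Prop :=
  generalized_resolvent U T S G /\ analytic_on U G.

Definition neighborhood0 (U : set R[i]^o) : Prop := open U /\ U 0.

End Pencils.

(* Main.v *)
Require Import Defs.
From mathcomp Require Import all_boot all_order all_algebra.
From mathcomp Require Import complex.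
From mathcomp Require Import boolp classical_sets functions reals.
From mathcomp Require Import topology normedtype.
From mathcomp Require Import sesquilinear sequences ring lra.
Import Order.TTheory GRing.Theory Num.Theory.
Import numFieldNormedType.Exports.
Local Open Scope classical_set_scope.
Local Open Scope ring_scope.

Set Implicit Arguments.
Unset Strict Implicit.
Unset Printing Implicit Defensive.

(** If the range of [A] is closed, the open mapping theorem and the projection
    theorem give a Moore-Penrose inverse [A^+]; moreover [A A^+] and [A^+ A] are
    the orthogonal projections on [R(A)] and on the orthogonal complement of
    [N(A)].

    When kernel and range of [A_l = T - l S] do not depend on [l], neither do
    these projections [P] and [Q], so
    [(l - m) A_l^+ S A_m^+ = A_l^+ (A_m - A_l) A_m^+ = A_l^+ P - Q A_m^+
    = A_l^+ - A_m^+].  Iterating this identity expands [A_l^+] in the Neumann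
    series [sum_n (l - l0)^n (A_l0^+ S)^n A_l0^+], whence analyticity.

    Conversely the resolvent identity makes the kernel and the range of [G l]
    independent of [l], and for a Moore-Penrose inverse [N(A_l)] and [R(A_l)]
    are the orthogonal complements of [R(G l)] and [N(G l)]. *)

(** * Real-valued norms, geometric convergence and subspaces *)

Section RealNorm.
Context {R : realType}.

(** Norms lie in [R[i]]; passing to the real part loses nothing and makes infima and [nra] in [R]
    available. *)
Definition nrm (V : normedModType R[i]) (x : V) : R := complex.Re `|x|.

Section NormedModule.
Variable V : normedModType R[i].
Implicit Types (x y : V) (r : R).

Lemma nrmE x : (nrm x)%:C%C = `|x|.
Proof. exact: Re_normK. Qed.

Lemma nrm_le x (M : R) : (`|x| <= M%:C%C) = (nrm x <= M).
Proof. by rewrite -nrmE lecR. Qed.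

Lemma nrm_ge0 x : 0 <= nrm x.
Proof. by rewrite -lecR nrmE normr_ge0. Qed.

Lemma nrm0 : nrm (0 : V) = 0.
Proof. by rewrite /nrm normr0. Qed.

Lemma nrm_eq0 x : nrm x <= 0 -> x = 0.
Proof. by rewrite -nrm_le normr_le0 => /eqP. Qed.

Lemma nrmD x y : nrm (x + y) <= nrm x + nrm y.
Proof. by rewrite -nrm_le raddfD /= !nrmE ler_normD. Qed.

Lemma nrmN x : nrm (- x) = nrm x.
Proof. by rewrite /nrm normrN. Qed.

Lemma nrmB x y : nrm (x - y) = nrm (y - x).
Proof. by rewrite -nrmN opprB. Qed.

Lemma nrm_dist_triangle y x z : nrm (x - z) <= nrm (x - y) + nrm (y - z).
Proof. by rewrite -(subrKA y) nrmD. Qed.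

Lemma nrmZC (c : R[i]) x : nrm (c *: x) = complex.Re `|c| * nrm x.
Proof.
apply: (@complexI R); rewrite nrmE normrZ rmorphM /= nrmE.
by rewrite (RRe_real (normr_real c)).
Qed.

Lemma nrmZ r x : 0 <= r -> nrm (r%:C%C *: x) = r * nrm x.
Proof. by move=> r0; rewrite nrmZC ger0_norm ?lecR. Qed.

End NormedModule.

Lemma bounded_op_nrm (V W : normedModType R[i]) (f : 'B(V, W)) x :
  nrm (f x) <= nrm f * nrm x.
Proof. by rewrite -nrm_le rmorphM /= !nrmE; exact: opnormP. Qed.

Lemma bounded_op_continuous (V W : normedModType R[i]) (f : 'B(V, W)) :
  continuous f.
Proof.
apply/linear_bounded_continuous/linear_boundedP.
exists (opnorm f); split; first by rewrite ger0_real ?opnorm_ge0.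
move=> r fr x; rewrite (le_trans (opnormP f x))// ler_wpM2r//.
exact: ltW.
Qed.

Lemma closed_null_space (V W : normedModType R[i]) (f : 'B(V, W)) :
  closed (null_space f).
Proof.
have -> : null_space f = f @^-1` [set 0] by apply/seteqP; split.
apply: preimage_closed => [x _|]; first exact: bounded_op_continuous.
exact: accessible_closed_set1 (hausdorff_accessible (@norm_hausdorff _ _)) _.
Qed.

Lemma half_expr_small (c e : R) : 0 < e -> exists N, forall n, (N <= n)%N ->
  c * 2^-1 ^+ n < e.
Proof.
move=> e0; exists (Num.truncn (`|c| / e)).+1 => n Nn.
rewrite (le_lt_trans (ler_norm _))// normrM normrX.
rewrite (@ger0_norm _ 2^-1) ?invr_ge0 ?ler0n// exprVn.
rewrite ltr_pdivrMr ?exprn_gt0 ?ltr0n//.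
rewrite -ltr_pdivrMl// mulrC (lt_le_trans (truncnS_gt _))//.
by rewrite -natrX ler_nat (leq_trans Nn)// ltnW// ltn_expl.
Qed.

Lemma ler_half_expr (a b c : R) : (forall n, a <= b + c * 2^-1 ^+ n) -> a <= b.
Proof.
move=> abc; rewrite leNgt; apply/negP => ba.
have [|N /(_ _ (leqnn N)) cN] := @half_expr_small c (a - b).
  by rewrite subr_gt0.
have := abc N; lra.
Qed.

Lemma nrm_cvg (V : normedModType R[i]) (u : nat -> V) l (c : R) :
  (forall n, nrm (l - u n) <= c * 2^-1 ^+ n) -> u @ \oo --> l.
Proof.
move=> ul; apply/cvgrPdist_lt => e e0.
have e0' : 0 < complex.Re e by rewrite -ltcR RRe_real// gtr0_real.
have [N cN] := @half_expr_small c _ e0'.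
exists N => // n /= Nn; rewrite -nrmE -(RRe_real (gtr0_real e0)) ltcR.
exact: le_lt_trans (ul n) (cN n Nn).
Qed.

(* Completeness in the only form needed: steps dominated by a sequence that   *)
(* at least halves.                                                           *)
Lemma halving_cvg (V : completeNormedModType R[i]) (u : nat -> V)
    (r : nat -> R) :
  (forall n, r n.+1 <= r n / 2) -> (forall n, nrm (u n.+1 - u n) <= r n) ->
  exists l, u @ \oo --> l /\ forall n, nrm (l - u n) <= 2 * r n.
Proof.
move=> rS ur.
have r0 n : 0 <= r n by exact: le_trans (nrm_ge0 _) (ur n).
have rn n : r n <= r 0%N * 2^-1 ^+ n.
  elim: n => [|n IH]; first by rewrite mulr1.
  by rewrite exprSr mulrA (le_trans (rS n))// ler_wpM2r ?invr_ge0 ?ler0n.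
(* The subtracted term makes the induction close: the next step is at most [r (n + k)], and
   [2 * r (n + k).+1 <= r (n + k)]. *)
have tail n k : nrm (u (n + k)%N - u n) <= 2 * r n - 2 * r (n + k)%N.
  elim: k => [|k IH]; first by rewrite addn0 !subrr nrm0.
  rewrite addnS (le_trans (nrm_dist_triangle (u (n + k)%N) _ _))//.
  by have := ur (n + k)%N; have := rS (n + k)%N; lra.
have tail2 n m : (n <= m)%N -> nrm (u m - u n) <= 2 * r n.
  move=> /subnKC <-; apply: le_trans (tail _ _) _.
  by have := r0 (n + (m - n))%N; lra.
have : cvg (u @ \oo).
  apply: cauchy_cvg; apply: cauchy_exP => e e0; rewrite /fmapE -ball_normE.
  have e0' : 0 < complex.Re e by rewrite -ltcR RRe_real// gtr0_real.
  have [N cN] := @half_expr_small (2 * r 0%N) _ e0'.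
  exists (u N), N => // m /= Nm.
  rewrite -nrmE -(RRe_real (gtr0_real e0)) ltcR nrmB.
  apply: le_lt_trans (tail2 _ _ Nm) _; apply: le_lt_trans (cN _ (leqnn N)).
  by have := rn N; lra.
move=> /cvg_ex[l ul]; exists l; split=> // n.
(* The bound passes to the limit: a violation would persist for some [u m] close to [l], against
   [tail2]. *)
rewrite leNgt; apply/negP => gap.
have /cvgrPdist_lt/(_ (nrm (l - u n) - 2 * r n)%:C%C) := ul.
rewrite ltcR subr_gt0 => /(_ gap)[N _ /(_ _ (leq_maxl N n))].
rewrite -nrmE ltcR; set m := maxn N n.
have := tail2 n m (leq_maxr N n).
have := nrm_dist_triangle (u m) l (u n); lra.
Qed.

Definition subspace (V : normedModType R[i]) (M : set V) : Prop :=
  M 0 /\ forall a x y, M x -> M y -> M (a *: x + y).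

Lemma subspace_null (V W : normedModType R[i]) (f : 'B(V, W)) :
  subspace (null_space f).
Proof.
split; first exact: linear0.
rewrite /null_space /= => a x y fx fy.
by rewrite linearP /= fx fy scaler0 addr0.
Qed.

Lemma subspace_range (V W : normedModType R[i]) (f : 'B(V, W)) :
  subspace (range f).
Proof.
split; first by exists 0; rewrite ?linear0.
by move=> a _ _ [x _ <-] [y _ <-]; exists (a *: x + y); rewrite ?linearP.
Qed.

End RealNorm.

(** * Orthogonality and projection onto closed subspaces *)

Section Hilbert.
Context {R : realType}.
Variable H : hilbertType R.
Implicit Types (x y u v : H) (M : set H).

Lemma inner_nrm x : inner x x = (nrm x)%:C%C ^+ 2.
Proof. by rewrite -normr_sqr_inner nrmE. Qed.

Lemma inner_conj x y : inner x y = Num.conj (inner y x).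
Proof. by rewrite (hermC (@inner R H)) expr0 mul1r. Qed.

Lemma inner_sym0 x y : inner x y = 0 -> inner y x = 0.
Proof. by move=> xy; rewrite inner_conj xy conjC0. Qed.

Lemma inner_eq0 x : inner x x = 0 -> x = 0.
Proof. by move=> /eqP; rewrite dnorm_eq0 => /eqP. Qed.

Lemma parallelogram x y :
  nrm (x + y) ^+ 2 + nrm (x - y) ^+ 2 = 2 * nrm x ^+ 2 + 2 * nrm y ^+ 2.
Proof.
apply: (@complexI R); rewrite !rmorphD /= !rmorphM /= -!expr2.
rewrite -!inner_nrm rmorph_nat.
by rewrite dnormD dnormB; ring.
Qed.

Lemma pythagoras x y : inner x y = 0 ->
  nrm (x + y) ^+ 2 = nrm x ^+ 2 + nrm y ^+ 2.
Proof.
move=> xy; apply: (@complexI R); rewrite rmorphD !rmorphXn /=.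
by rewrite -!inner_nrm dnormD /= xy conjC0 !addr0.
Qed.

Lemma pythagoras_le x y : inner x y = 0 -> nrm x <= nrm (x + y).
Proof.
move=> /pythagoras xy; rewrite -(@ler_pXn2r _ 2)// ?nnegrE ?nrm_ge0// xy.
by rewrite lerDl sqr_ge0.
Qed.

(** Subtracting from [u] a small multiple of [inner u v *: v] would shorten it if the inner product
    were nonzero. *)
Lemma minimal_nrm_orthogonal u v :
  (forall a : R[i], nrm u <= nrm (u - a *: v)) -> inner u v = 0.
Proof.
move=> uv; set c := inner u v.
(* With this [s], the squared norm drops by [s k^2 (2 - s |v|^2)], where [s |v|^2 < 1]; the added 1
   covers [v = 0]. *)
have s0 : 0 < (nrm v ^+ 2 + 1)^-1 by rewrite invr_gt0 ltr_wpDl ?sqr_ge0.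
set s := _^-1 in s0; pose k := complex.Re `|c|.
have kE : k%:C%C = `|c| by rewrite RRe_real// normr_real.
have k0 : 0 <= k by rewrite -lecR kE normr_ge0.
have uE : nrm (u - (s%:C%C * c) *: v) ^+ 2 =
    nrm u ^+ 2 - 2 * s * k ^+ 2 + s ^+ 2 * k ^+ 2 * nrm v ^+ 2.
  apply: (@complexI R); rewrite !(rmorphD, rmorphB, rmorphM, rmorphXn) /= kE.
  rewrite -!expr2 -!inner_nrm dnormB /= dnormZ normrM linearZr /= -/c.
  have sC : Num.conj (s%:C%C : R[i]) = s%:C%C.
    by apply: conj_Creal; rewrite ger0_real// lecR ltW.
  rewrite rmorphN !rmorphM /= -!expr2 kE rmorph_nat !sC conjCK.
  rewrite (@ger0_norm _ s%:C%C) ?lecR ?ltW// exprMn !normCK; ring.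
have := uv (s%:C%C * c); rewrite -(@ler_pXn2r _ 2)// ?nnegrE ?nrm_ge0// uE => le.
have sv : s * (nrm v ^+ 2 + 1) = 1.
  by rewrite mulVf// gt_eqF// ltr_wpDl ?sqr_ge0.
have k20 : k ^+ 2 <= 0.
  have := sqr_ge0 k; move: le sv s0; set t := nrm v ^+ 2; set k2 := k ^+ 2.
  move=> le sv s0 kk; have : s * k2 * (2 - s * t) <= 0 by nra.
  rewrite pmulr_lle0; first by nra.
  have : s * t < 1 by nra.
  nra.
have {k20}kz : k = 0 by apply/eqP; rewrite -sqrf_eq0 eq_le k20 sqr_ge0.
by apply/eqP; rewrite -normr_eq0 -kE kz.
Qed.

Lemma orthogonal_projection M x : closed M -> subspace M ->
  exists2 m, M m & forall v, M v -> inner (x - m) v = 0.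
Proof.
move=> clM [M0 Mlin].
have MD a b : M a -> M b -> M (a + b).
  by move=> Ma Mb; rewrite -[a]scale1r; exact: Mlin.
have MZ a b : M b -> M (a *: b).
  by move=> Mb; rewrite -[_ *: _]addr0; exact: Mlin.
pose E := [set nrm (x - m) ^+ 2 | m in M].
have E0 : has_inf E.
  split; first by exists (nrm (x - 0) ^+ 2), 0.
  by exists 0 => _ [m _ <-]; exact: sqr_ge0.
set d := inf E.
have dle m : M m -> d <= nrm (x - m) ^+ 2.
  by move=> Mm; apply: ge_inf; [exact: E0.2|exists m].
have /choice[m mP] n : exists m, M m /\ nrm (x - m) ^+ 2 < d + (2^-1 ^+ n) ^+ 2.
  have [|_ [m Mm <-] ?] := @inf_adherent _ E ((2^-1 ^+ n) ^+ 2) _ E0.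
    by rewrite !exprn_gt0// invr_gt0 ltr0n.
  by exists m.
have hS n : 2^-1 ^+ n.+1 = 2^-1 ^+ n / 2 :> R by rewrite exprSr.
have h0 n : 0 < 2^-1 ^+ n :> R by rewrite exprn_gt0// invr_gt0 ltr0n.
have h1 n : 2^-1 ^+ n <= 1 :> R.
  by rewrite exprn_ile1 ?invr_ge0 ?ler0n ?invf_le1 ?ltr0n ?ler1n.
have [l [ml lm]] : exists l, m @ \oo --> l /\
    forall n, nrm (l - m n) <= 2 * (2 * 2^-1 ^+ n).
  apply: (@halving_cvg _ _ _ (fun n => 2 * 2^-1 ^+ n)) => n.
    by rewrite hS; lra.
  (* The midpoint is at squared distance at least [d] from [x], so the parallelogram law bounds the
     squared step by [5/2 * 4^-n]. *)
  have /dle midE : M (2^-1 *: (m n + m n.+1)).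
    by apply: MZ; apply: MD; [exact: (mP n).1|exact: (mP n.+1).1].
  have := parallelogram (x - m n) (x - m n.+1).
  have -> : x - m n + (x - m n.+1) = 2%:C%C *: (x - 2^-1 *: (m n + m n.+1)).
    rewrite rmorph_nat scalerBr scalerA mulfV ?pnatr_eq0// scale1r scaler_nat.
    by rewrite mulr2n opprD addrACA.
  have -> : x - m n - (x - m n.+1) = m n.+1 - m n.
    by rewrite opprB addrC subrKA.
  rewrite nrmZ ?ler0n// exprMn => par.
  rewrite -(@ler_pXn2r _ 2)// ?nnegrE ?nrm_ge0 ?mulr_ge0 ?ler0n// ?ltW//.
  have := (mP n).2; have := (mP n.+1).2; have := h0 n; rewrite hS.
  move: (2^-1 ^+ n) => q q0; nra.
have Ml : M l.
  by apply: (closed_cvg _ clM _ _ ml); apply: nearW => n; exact: (mP n).1.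
have ld : nrm (x - l) ^+ 2 <= d.
  (* The constant bounds [q^2 + 8 a q + 16 q^2] by a multiple of [q = 2^-n], using [a <= d + 2] and
     [q^2 <= q]. *)
  apply: (@ler_half_expr _ _ _ (1 + 2 * (d + 2) * 4 + 16)) => n.
  have := nrm_dist_triangle (m n) x l; have := lm n; rewrite (nrmB l).
  have := (mP n).2; have := h0 n; have := h1 n; have := nrm_ge0 (x - l).
  have := nrm_ge0 (x - m n); have := dle _ (mP n).1.
  move: (nrm (x - m n)) (nrm (x - l)) (nrm (m n - l)) (2^-1 ^+ n) => a b c q.
  move=> da a0 b0 q1 q0 ad cq bac.
  have b1 : b <= a + 4 * q by lra.
  have b2 : b ^+ 2 <= (a + 4 * q) ^+ 2.
    by rewrite ler_pXn2r// ?nnegrE//; lra.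
  have qq : q ^+ 2 <= q by rewrite expr2 ler_piMr// ltW.
  have ad2 : a <= d + 2 by have := sqr_ge0 (a - 1); nra.
  have : a * q <= (d + 2) * q by rewrite ler_wpM2r// ltW.
  nra.
exists l => // v Mv; apply: minimal_nrm_orthogonal => a.
rewrite -(@ler_pXn2r _ 2)// ?nnegrE ?nrm_ge0// (le_trans ld)//.
by rewrite -addrA -opprD; apply: dle; rewrite addrC; exact: Mlin.
Qed.

End Hilbert.

(** * The open mapping theorem onto a closed range *)

Section OpenMapping.
Context {R : realType}.
Variables (X Y : completeNormedModType R[i]) (T : 'B(X, Y)).
Hypothesis clT : closed (range T).

(** Baire's argument in the complete space [range T]: otherwise shrinking balls could avoid the
    images of all balls [nrm x <= n] in turn, yet their centers converge to a point of the range. *)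
Lemma baire_range : exists (n : nat) (z0 : Y) (r : R),
  [/\ 0 < r, range T z0 & forall z, range T z -> nrm (z - z0) < r ->
      forall e : R, 0 < e -> exists2 x, nrm x <= n%:R & nrm (z - T x) < e].
Proof.
apply: contrapT => no.
have step (p : nat * (Y * R)) : exists q : Y * R,
    range T p.2.1 -> 0 < p.2.2 ->
    [/\ range T q.1, 0 < q.2, q.2 <= p.2.2 / 2, nrm (q.1 - p.2.1) < p.2.2 / 4 &
        forall x, nrm x <= p.1%:R -> q.2 <= nrm (q.1 - T x)].
  case: p => n [z0 r] /=; apply: contrapT => /forallNP nq; apply: no.
  (* The failing implication itself supplies the hypotheses on [z0] and [r]. *)
  have /not_implyP[Tz0 /not_implyP[r0 _]] := nq (z0, r).
  exists n, z0, (r / 4); split=> //; first by rewrite divr_gt0 ?ltr0n.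
  move=> z Tz zr e e0; apply: contrapT => far.
  apply: (nq (z, Num.min e (r / 2))) => _ _; split=> //=.
  - by rewrite lt_min e0 divr_gt0 ?ltr0n.
  - by rewrite ge_min lexx orbT.
  - move=> x xn; rewrite ge_min; apply/orP; left; rewrite leNgt.
    by apply/negP => zx; apply: far; exists x.
have {step} [f fP] := choice step.
pose fix s n := if n is k.+1 then f (k, s k) else (0 : Y, 1 : R).
have sP n : range T (s n).1 /\ 0 < (s n).2.
  elim: n => [|n [Tn rn]] /=; first by split=> //; exists 0; rewrite ?linear0.
  by have [] := fP (n, s n) Tn rn.
have sS n := fP (n, s n) (sP n).1 (sP n).2.
have [|n|l [sl ls]] := @halving_cvg _ _ (fun n => (s n).1) (fun n => (s n).2 / 4).
- by move=> n; have [_ _ /= h _ _] := sS n; lra.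
- by have [_ _ _ /= h _] := sS n; exact: ltW.
have [x _ Tx] : range T l.
  by apply: (closed_cvg _ clT _ _ sl); apply: nearW => n; exact: (sP n).1.
pose n := (Num.truncn (nrm x)).+1.
have xn : nrm x <= n%:R by rewrite ltW// truncnS_gt.
(* The limit [T x] is within half the radius of the ball number [n.+1], which keeps a full radius
   away from it. *)
have [_ + _ _ /(_ x xn)] := sS n; rewrite /= Tx nrmB.
have := ls n.+1; rewrite /=; lra.
Qed.

Lemma range_half_approx : exists2 C : R, 0 <= C & forall z, range T z ->
  exists2 x, nrm x <= C * nrm z & nrm (z - T x) <= nrm z / 2.
Proof.
have [n [z0 [r [r0 Tz0 near0]]]] := baire_range.
exists (n%:R * 4 / r) => [|z Tz].
  by rewrite divr_ge0 ?mulr_ge0 ?ler0n// ltW.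
have [z00|zN0] := eqVneq (nrm z) 0.
  have -> : z = 0 by apply: nrm_eq0; rewrite z00.
  by exists 0; rewrite ?linear0 ?addr0 !nrm0 ?mulr0 ?mul0r.
have nz : 0 < nrm z by rewrite lt_def zN0 nrm_ge0.
(* Scaling by [a] puts [z + z0 / a] inside the ball about [z0]. Two approximations with error
   [r / 8] then differ from [a z] by at most [r / 4], which is [a * (nrm z / 2)]. *)
pose a := r / 2 / nrm z.
have a0 : 0 < a by rewrite !divr_gt0 ?ltr0n.
have ai0 : 0 <= a^-1 by rewrite invr_ge0 ltW.
have Tlin : subspace (range T) by exact: subspace_range.
have e0 : 0 < r / 8 by rewrite divr_gt0 ?ltr0n.
have az : nrm (a%:C%C *: z) = r / 2 by rewrite nrmZ ?ltW// divfK ?gt_eqF.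
have [|x1 x1n zx1] := near0 (a%:C%C *: z + z0) (Tlin.2 _ _ _ Tz Tz0) _ _ e0.
  by rewrite addrK az; lra.
have [|x2 x2n zx2] := near0 z0 Tz0 _ _ e0; first by rewrite subrr nrm0.
exists ((a^-1)%:C%C *: (x1 - x2)).
  have -> : n%:R * 4 / r * nrm z = a^-1 * (n%:R * 2).
    by rewrite /a; field; rewrite !gt_eqF.
  rewrite nrmZ// ler_pM2l ?invr_gt0//.
  have := nrmD x1 (- x2); rewrite nrmN; lra.
have -> : z - T ((a^-1)%:C%C *: (x1 - x2)) =
    (a^-1)%:C%C *: ((a%:C%C *: z + z0 - T x1) - (z0 - T x2)).
  rewrite linearZ linearB /= !opprB addrAC addrACA subrr addr0 -addrA.
  rewrite [RHS]scalerDr scalerA -rmorphM /= mulVf ?gt_eqF// scale1r.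
  by rewrite -scalerN opprB.
rewrite nrmZ//.
have := nrmD (a%:C%C *: z + z0 - T x1) (- (z0 - T x2)); rewrite nrmN => d.
rewrite ler_pdivrMl//.
have -> : a * (nrm z / 2) = r / 4 by rewrite /a; field.
lra.
Qed.

Lemma open_mapping_range : exists2 C : R, 0 <= C & forall z, range T z ->
  exists2 x, T x = z & nrm x <= C * nrm z.
Proof.
have [C C0 half] := range_half_approx.
have /choice[f fP] z : exists x, range T z ->
    nrm x <= C * nrm z /\ nrm (z - T x) <= nrm z / 2.
  have [/half[x]|nz] := pselect (range T z); first by exists x.
  by exists 0.
exists (2 * C) => [|z Tz]; first by rewrite mulr_ge0.
(* Successive correction: [s] accumulates approximate preimages while the residual [w] at least
   halves, so the total length is at most [2 * C * nrm z]. *)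
pose fix s n : X := if n is k.+1 then s k + f (z - T (s k)) else 0.
pose w n := z - T (s n).
have Tw n : range T (w n).
  by rewrite /w addrC -scaleN1r; apply: (subspace_range T).2.
have wS n : w n.+1 = w n - T (f (w n)) by rewrite /w /= linearD opprD addrA.
have w2 n : nrm (w n.+1) <= nrm (w n) / 2 by rewrite wS; exact: (fP _ (Tw n)).2.
have wn n : nrm (w n) <= nrm z * 2^-1 ^+ n.
  elim: n => [|n IH]; first by rewrite /w /= linear0 subr0 mulr1.
  by rewrite exprSr mulrA (le_trans (w2 n))// ler_wpM2r ?invr_ge0 ?ler0n.
have [n|n|l [_ ls]] := @halving_cvg _ _ s (fun n => C * nrm (w n)).
- by rewrite -mulrA ler_wpM2l.
- by rewrite /= addrAC subrr add0r; exact: (fP _ (Tw n)).1.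
exists l; last first.
  by have := ls 0%N; rewrite /w /= !linear0 !addr0 mulrA.
apply/esym/eqP; rewrite -subr_eq0; apply/eqP/nrm_eq0.
apply: (@ler_half_expr _ _ _ (nrm z + nrm T * (2 * (C * nrm z)))) => n.
have -> : z - T l = w n - T (l - s n).
  by rewrite /w linearB /= opprB addrA subrK.
rewrite add0r (le_trans (nrmD _ _))// nrmN mulrDl lerD//.
apply: le_trans (bounded_op_nrm _ _) _; rewrite -!mulrA ler_wpM2l ?nrm_ge0//.
by rewrite (le_trans (ls n))// !ler_wpM2l ?ler0n.
Qed.

End OpenMapping.

(** * Existence and orthogonality relations of Moore-Penrose inverses *)

Section MoorePenrose.
Context {R : realType}.
Variables X Y : hilbertType R.
Implicit Types (A : 'B(X, Y)) (B : 'B(Y, X)).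

Lemma closed_range_moore_penrose A : closed (range A) ->
  exists B, is_moore_penrose A B.
Proof.
move=> clA.
(* [P y x] says that [x] is orthogonal to the kernel and that [A x] is the    *)
(* orthogonal projection of [y] on the range.                                 *)
pose P y x := (forall n, A n = 0 -> inner x n = 0) /\
  (forall v, inner (y - A x) (A v) = 0).
have Puniq y x x' : P y x -> P y x' -> x = x'.
  move=> [xN xR] [xN' xR']; apply/eqP; rewrite -subr_eq0; apply/eqP.
  have Ax : A (x - x') = 0.
    apply: inner_eq0; rewrite {1}linearB /=.
    have -> : A x - A x' = (y - A x') - (y - A x) by rewrite opprB [RHS]addrC subrKA.
    by rewrite linearBl /= xR xR' subrr.
  by apply: inner_eq0; rewrite {1}linearBl /= xN// xN'// subrr.
have Plin a y z u v : P y u -> P z v -> P (a *: y + z) (a *: u + v).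
  move=> [uN uR] [vN vR]; split=> [n An|w].
    by rewrite linearPl /= uN// vN// mulr0 addr0.
  have -> : a *: y + z - A (a *: u + v) = a *: (y - A u) + (z - A v).
    by rewrite linearP opprD addrACA scalerBr.
  by rewrite linearPl /= uR vR mulr0 addr0.
have [C C0 om] := open_mapping_range clA.
have Pex y : exists x, P y x.
  (* Project [y] on the range, take a preimage [x0], and remove its component in the kernel. *)
  have [_ [x0 _ <-] zR] := orthogonal_projection y clA (subspace_range A).
  have [n An nN] := orthogonal_projection x0 (@closed_null_space _ _ _ A)
    (subspace_null A).
  have {}An : A n = 0 by [].
  exists (x0 - n); split=> [m Am|v]; first exact: nN.
  by rewrite linearB /= An subr0; apply: zR; exists v.
have [f fP] := choice Pex.
have flin : linear f by move=> a y z; apply: Puniq (fP _) (Plin _ _ _ _ _ _ _).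
have fle y : nrm (f y) <= C * nrm y.
  have [fN fR] := fP y.
  (* The open mapping bound holds for some preimage [x'] of [A (f y)]; [f y], orthogonal to the
     kernel, is no longer than [x']. *)
  have [x' x'E x'le] := om (A (f y)) (ex_intro2 _ _ (f y) I erefl).
  have fx' : nrm (f y) <= nrm x'.
    have := @pythagoras_le _ _ (f y) (x' - f y); rewrite [f y + _]addrC subrK; apply.
    by apply: fN; rewrite linearB /= x'E subrr.
  apply: le_trans fx' (le_trans x'le _); apply: ler_wpM2l => //.
  have := @pythagoras_le _ _ (A (f y)) (y - A (f y)); rewrite [A (f y) + _]addrC subrK.
  by apply; apply: inner_sym0.
have fB : f \in @bounded_linear R Y X.
  rewrite inE; split=> //; exists C%:C%C => y.
  by rewrite -!nrmE -rmorphM lecR.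
pose B : 'B(Y, X) := BoundedOp fB.
have fA x : A (f (A x)) = A x.
  apply/esym/eqP; rewrite -subr_eq0; apply/eqP/inner_eq0.
  by rewrite -{2}linearB; exact: (fP (A x)).2.
exists B; split.
- by apply/bounded_op_eqP => x; exact: fA.
- apply/bounded_op_eqP => y; apply: (@Puniq (A (f y))); first exact: fP.
  by split=> [|v]; [exact: (fP y).1|rewrite subrr linear0l].
- apply: adjointE => y z /=.
  (* The product sees only the projection of [v]; conjugate symmetry then gives self-adjointness. *)
  have h u v : inner (A (f u)) v = inner (A (f u)) (A (f v)).
    apply/eqP; rewrite -subr_eq0 -linearBr /=; apply/eqP/inner_sym0.
    exact: (fP v).2.
  by rewrite (h y z) [LHS]inner_conj [RHS]inner_conj (h z y).
- apply: adjointE => x z /=.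
  have h u v : inner (f (A u)) v = inner (f (A u)) (f (A v)).
    apply/eqP; rewrite -subr_eq0 -linearBr /=; apply/eqP.
    by apply: (fP (A u)).1; rewrite linearB /= fA subrr.
  by rewrite (h x z) [LHS]inner_conj [RHS]inner_conj (h z x).
Qed.

(* If no operator satisfies the adjoint identity, [adjoint A] is the default  *)
(* value 0, for which [adjoint A = A] makes the conclusion trivial.           *)
Lemma adjoint_id_sym (H : hilbertType R) (A : 'B(H, H)) : adjoint A = A ->
  forall x y, inner (A x) y = inner x (A y).
Proof.
rewrite /adjoint; case: xgetP => [B _ BP BA|_ <-] x y.
  by rewrite -[in RHS]BA; exact: BP.
by rewrite linear0l linear0r.
Qed.

Section Identities.
Variables (A : 'B(X, Y)) (B : 'B(Y, X)).
Hypothesis AB : is_moore_penrose A B.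

Lemma moore_penrose_ABA x : A (B (A x)) = A x.
Proof. by case: AB => /bounded_op_eqP/(_ x). Qed.

Lemma moore_penrose_BAB y : B (A (B y)) = B y.
Proof. by case: AB => _ /bounded_op_eqP/(_ y). Qed.

Lemma moore_penrose_AB_sym y z : inner (A (B y)) z = inner y (A (B z)).
Proof. by case: AB => _ _ /adjoint_id_sym h _; exact: h. Qed.

Lemma moore_penrose_BA_sym x z : inner (B (A x)) z = inner x (B (A z)).
Proof. by case: AB => _ _ _ /adjoint_id_sym h; exact: h. Qed.

(** [B A] is a symmetric idempotent with the kernel of [A] and the range of [B]. *)
Lemma moore_penrose_null x : A x = 0 <-> forall y, inner x (B y) = 0.
Proof.
split=> [Ax y|xB].
  by rewrite -moore_penrose_BAB -moore_penrose_BA_sym Ax linear0 linear0l.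
rewrite -moore_penrose_ABA; have -> : B (A x) = 0; last by rewrite linear0.
apply: inner_eq0; rewrite moore_penrose_BA_sym moore_penrose_BAB; exact: xB.
Qed.

Lemma moore_penrose_range y :
  range A y <-> forall z, B z = 0 -> inner y z = 0.
Proof.
split=> [[x _ <-] z Bz|yB].
  by rewrite -moore_penrose_ABA moore_penrose_AB_sym Bz linear0 linear0r.
exists (B y) => //; apply/esym/eqP; rewrite -subr_eq0; apply/eqP.
have By : B (y - A (B y)) = 0 by rewrite linearB /= moore_penrose_BAB subrr.
by apply: inner_eq0; rewrite linearBl /= yB// moore_penrose_AB_sym By
  linear0 linear0r subrr.
Qed.

End Identities.

(** [A' B'] fixes the common range, so [A' B' A B = A B]; taking adjoints gives
    [A B A' B' = A B]. *)
Lemma moore_penrose_range_eq A A' B B' :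
  is_moore_penrose A B -> is_moore_penrose A' B' -> range A = range A' ->
  forall y, B (A' (B' y)) = B y.
Proof.
move=> AB AB' rA y; rewrite -(moore_penrose_BAB AB) -[RHS](moore_penrose_BAB AB).
congr (B _); apply: inner_ext => z.
rewrite -!(moore_penrose_AB_sym AB) -(moore_penrose_AB_sym AB').
have [x _ <-] : range A' (A (B z)) by rewrite -rA; exists (B z).
by rewrite (moore_penrose_ABA AB').
Qed.

(** The difference lies in the common kernel, which is orthogonal to the ranges of [B] and [B'],
    hence to the difference itself. *)
Lemma moore_penrose_null_eq A A' B B' :
  is_moore_penrose A B -> is_moore_penrose A' B' ->
  null_space A = null_space A' -> forall y, B' (A' (B y)) = B y.
Proof.
move=> AB AB' nA y; apply/esym/eqP; rewrite -subr_eq0; apply/eqP.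
set w := B y - _; have A'w : null_space A' w.
  by rewrite /null_space /= linearB /= (moore_penrose_ABA AB') subrr.
have Aw : null_space A w by rewrite nA.
apply: inner_eq0; rewrite {2}/w linearBr /=.
by rewrite (moore_penrose_null AB _).1// (moore_penrose_null AB' _).1// subrr.
Qed.

End MoorePenrose.

(** * Consequences of the resolvent identity *)

Section Pencil.
Context {R : realType}.

Lemma resolvent_analytic (X Y : normedModType R[i]) (U : set R[i]^o)
    (T S : 'B(X, Y)) (G : R[i] -> 'B(Y, X)) :
  open U -> generalized_resolvent U T S G -> analytic_on U G.
Proof.
move=> oU [_ _ res] l0 Ul0.
pose F (A : 'B(Y, X)) : 'B(Y, X) := G l0 \oB S \oB A.
have FZ c A : F (c *: A) = c *: F A.
  by apply/bounded_op_eqP => y; rewrite /= !linearZ.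
have FB A B : F (A - B) = F A - F B.
  by apply/bounded_op_eqP => y; rewrite /= !linearB.
have Fle A : nrm (F A) <= nrm (G l0) * nrm S * nrm A.
  rewrite -nrm_le; apply: opnorm_le => [|y].
    by rewrite lecR !mulr_ge0 ?nrm_ge0.
  rewrite -!nrmE -rmorphM lecR /= -!mulrA.
  apply: le_trans (bounded_op_nrm _ _) _; rewrite ler_wpM2l ?nrm_ge0//.
  apply: le_trans (bounded_op_nrm _ _) _; rewrite ler_wpM2l ?nrm_ge0//.
  exact: bounded_op_nrm.
have iterZ n c A : iter n F (c *: A) = c *: iter n F A.
  by elim: n => //= n ->.
have iterB n A B : iter n F (A - B) = iter n F A - iter n F B.
  by elim: n => //= n ->.
exists (fun n => iter n F (G l0)).
(* Adding 1 keeps [K] positive; within [1 / (2 K)] of [l0], each application of [(l - l0) F] at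
   least halves the norm. *)
pose K := nrm (G l0) * nrm S + 1.
have K0 : 0 < K by rewrite ltr_wpDl ?mulr_ge0 ?nrm_ge0.
have d0 : 0 < ((2 * K)^-1)%:C%C :> R[i] by rewrite ltcR invr_gt0 mulr_gt0.
have nU : \forall l \near l0, U l by apply: open_nbhs_nbhs.
have nd : \forall l \near l0, `|l - l0| < ((2 * K)^-1)%:C%C.
  apply/nbhs_ballP; exists ((2 * K)^-1)%:C%C => //= l.
  by rewrite -ball_normE /= distrC.
near=> l.
have Ul : U l by near: l.
have dl : nrm (l - l0 : R[i]^o) * K <= 2^-1.
  have h : nrm (l - l0 : R[i]^o) < (2 * K)^-1 by rewrite -ltcR nrmE; near: l.
  rewrite -ler_pdivlMr//; apply: ltW; apply: lt_le_trans h _.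
  by rewrite invfM.
(* Since [G l = G l0 + (l - l0) F (G l)], the remainder is exact, which identifies the limit as
   [G l]. *)
have rem n : G l - series (fun k => (l - l0) ^+ k *: iter k F (G l0)) n =
    (l - l0) ^+ n *: iter n F (G l).
  elim: n => [|n IH]; first by rewrite /series /= big_geq// subr0 expr0 scale1r.
  rewrite /series /= big_nat_recr//= opprD addrA IH -scalerBr -iterB.
  have -> : G l - G l0 = (l - l0) *: F (G l).
    by rewrite -opprB (res l0 l)// -scaleNr opprB.
  by rewrite iterZ scalerA -exprSr -iterSr.
apply: (@nrm_cvg _ _ _ _ (nrm (G l))) => n; rewrite rem {rem}.
elim: n => [|n IH]; first by rewrite expr0 scale1r mulr1.
rewrite exprS -scalerA /= -FZ nrmZC exprSr mulrA.
move: IH; set W := _ *: _ => IH.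
have FW : nrm (F W) <= K * nrm W.
  by rewrite (le_trans (Fle W))// ler_wpM2r ?nrm_ge0// lerDl.
apply: (@le_trans _ _ (nrm (l - l0 : R[i]^o) * K * nrm W)).
  rewrite -mulrA; apply: ler_wpM2l => //; exact: (@nrm_ge0 _ R[i]^o).
rewrite [leLHS]mulrC; apply: ler_pM => //; first exact: nrm_ge0.
by rewrite mulr_ge0 ?nrm_ge0 ?ltW.
Unshelve. all: by end_near.
Qed.

(** The identity includes the range and the kernel of [G m] in those of [G l]; orthogonal
    complements reverse these inclusions. *)
Lemma resolvent_moore_penrose_sub (X Y : hilbertType R) (U : set R[i]^o)
    (T S : 'B(X, Y)) (G : R[i] -> 'B(Y, X)) :
  (forall l, U l -> is_moore_penrose (T - l *: S) (G l)) ->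
  generalized_resolvent U T S G -> forall l m, U l -> U m ->
  null_space (T - l *: S) `<=` null_space (T - m *: S) /\
  range (T - l *: S) `<=` range (T - m *: S).
Proof.
move=> mp [_ _ res] l m Ul Um.
have resE a b y : U a -> U b ->
    G a y = G b y + (a - b) *: G a (S (G b y)).
  move=> Ua Ub; have /bounded_op_eqP/(_ y) := res a b Ua Ub.
  by rewrite bounded_opBE bounded_opZE /= => <-; rewrite addrC subrK.
split=> [x /(moore_penrose_null (mp l Ul)) xG|
         y /(moore_penrose_range (mp l Ul)) yG].
  apply/(moore_penrose_null (mp m Um)) => y.
  have -> : G m y = G l (y + (m - l) *: S (G m y)).
    by rewrite linearD linearZ /= -opprB scaleNr (resE l m) ?addrK.
  exact: xG.
apply/(moore_penrose_range (mp m Um)) => z Gz; apply: yG.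
by rewrite (resE l m)// Gz !linear0 addr0.
Qed.

End Pencil.

Theorem theorem2p6 (R : realType) (X Y : hilbertType R) (T S : 'B(X, Y))
    (closed_range : closed (range T)) :
  (exists U : set R[i]^o, neighborhood0 U /\
     exists G : R[i] -> 'B(Y, X),
       (forall l, U l -> is_moore_penrose (T - l *: S) (G l)) /\
       analytic_generalized_resolvent U T S G)
  <->
  (exists U : set R[i]^o, neighborhood0 U /\
     forall l, U l -> null_space (T - l *: S) = null_space T /\
                      range (T - l *: S) = range T).
Proof.
have T0 : T - 0 *: S = T by rewrite scale0r subr0.
split=> [[U [[oU U0] [G [mp [res _]]]]]|[U [[oU U0] NR]]]; exists U; split=> //.
  move=> l Ul.
  have [nl rl] := resolvent_moore_penrose_sub mp res Ul U0.
  have [n0 r0] := resolvent_moore_penrose_sub mp res U0 Ul.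
  by rewrite T0 in nl rl n0 r0; split; apply/seteqP; split.
have /choice[G mp] l : exists B, U l -> is_moore_penrose (T - l *: S) B.
  have [Ul|nU] := pselect (U l); last by exists 0.
  have [|B mpB] := @closed_range_moore_penrose _ _ _ (T - l *: S).
    by rewrite (NR l Ul).2.
  by exists B.
have res : generalized_resolvent U T S G.
  split=> [l /mp[]//|l /mp[]//|l m Ul Um].
  apply/bounded_op_eqP => y; rewrite bounded_opBE bounded_opZE /=.
  (* Inserting the common projections turns the difference into [G l] applied to the difference of
     the two pencils at [G m y]. *)
  rewrite -(moore_penrose_range_eq (mp l Ul) (mp m Um)); last first.
    by rewrite (NR l Ul).2 (NR m Um).2.
  rewrite -[X in _ - X](moore_penrose_null_eq (mp m Um) (mp l Ul)); last first.
    by rewrite (NR l Ul).1 (NR m Um).1.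
  rewrite -linearB /= -linearZ; congr (G l _).
  by rewrite scalerBl opprB addrC subrKA.
exists G; split=> //; split=> //; exact: resolvent_analytic oU res.
Qed.
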